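(* Let $k\ge 2$ and $n$ be integers with $n>k^2$. Then $$m(n,k,1)=m(k^2,k,1)+\binom{k^2}{k}+\binom{k^2+1}{k}+\cdots+\binom{n-1}{k}.$$
   Context: For integers $n\ge k+1$, let $\mathcal V(n,k,1)\subset\mathbb R^n$ be the set of all vectors with coordinates in $\{0,1,-1\}$ having exactly $k$ coordinates equal to $+1$ and exactly one coordinate equal to $-1$ (all other coordinates $0$). For $n\ge 2k$ the minimum possible scalar product of two vectors in $\mathcal V(n,k,1)$ is $-2$. A family $\mathcal V\subset\mathcal V(n,k,1)$ is called intersecting if $\langle v,w\rangle>-2$ for all $v,w\in\mathcal V$. Let $m(n,k,1)$ be the maximum of $|\mathcal V|$ over all intersecting families $\mathcal V\subset\mathcal V(n,k,1)$. *)

(* Defs.v *)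
From mathcomp Require Import all_boot all_order all_algebra finmap.

Set Implicit Arguments.
Unset Strict Implicit.
Unset Printing Implicit Defensive.

Import Order.TTheory GRing.Theory Num.Theory.
Local Open Scope fset_scope.
Local Open Scope ring_scope.

Definition scalar_prod (R : realFieldType) (n : nat) (v w : 'rV[R]_n) : R :=
  \sum_(i < n) v 0 i * w 0 i.

(* 'R^n' is infinite, so the finite set is carved out of the image of the
   finite type of matrices with entries in {0, 1, -1}; [in_Vnk1] below is the
   intended membership characterization. *)
Definition Vnk1 (R : realFieldType) (n k : nat) : {fset 'rV[R]_n} :=
  [fset v in [fset map_mx val u | u : 'rV[seq_sub [:: 0; 1; -1 : R]]_n]
  | (#|[set i | v 0 i == 1]| == k) && (#|[set i | v 0 i == -1]| == 1%N)].

Lemma in_Vnk1 (R : realFieldType) (n k : nat) (v : 'rV[R]_n) :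
  v \in Vnk1 R n k <->
  [/\ forall i, [\/ v 0 i = 0, v 0 i = 1 | v 0 i = -1],
      #|[set i | v 0 i == 1]| = k & #|[set i | v 0 i == -1]| = 1%N].
Proof.
rewrite /Vnk1 !inE; split.
- case/andP=> /imfsetP[u /= _ ->] /andP[/eqP ck /eqP c1]; split=> // i.
  have := ssvalP (u 0 i); rewrite mxE !inE.
  by case/or3P=> /eqP ->; [constructor 1 | constructor 2 | constructor 3].
- case=> vP -> ->; rewrite !eqxx !andbT.
  have vin i : v 0 i \in [:: 0; 1; -1 : R].
    by rewrite !inE; case: (vP i) => ->; rewrite eqxx ?orbT.
  apply/imfsetP; exists (\row_i SeqSub (vin i)) => //=.
  by apply/rowP=> i; rewrite !mxE.
Qed.

Definition intersecting (R : realFieldType) (n : nat) (F : {fset 'rV[R]_n}) :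
    bool :=
  [forall v : F, forall w : F, -2 < scalar_prod (val v) (val w)].

Definition mnk1 (R : realFieldType) (n k : nat) : nat :=
  (\max_(F <- fpowerset (Vnk1 R n k) | intersecting F) #|` F|)%N.

(* Main.v *)
Require Import Defs.
From mathcomp Require Import all_boot all_order all_algebra all_fingroup.
From mathcomp Require Import finmap zify ring lra.

(** It suffices that [mnk1 R (n + 1) k = mnk1 R n k + 'C(n, k)] for [n >= k ^ 2].

    Lower bound: to an intersecting family on [n] coordinates, extended by 0,
    add all vectors whose last coordinate is -1.

    Upper bound: swapping a coordinate with a larger last coordinate (a shift)
    preserves the intersecting property, so the family may be assumed closed
    under such swaps.  The vectors ending in 0 number at most [mnk1 R n k].  Let
    [A] be the [k]-sets of +1's of the vectors ending in -1, and let [B] be the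
    pairs (other +1's, position of -1) of the vectors ending in 1.  By
    shiftedness [(X, b) \in B] gives [b |: X \in A], and a set of [A] containing
    [b] must meet [X].  Put [q = k - 1].  Katona's circle method, with one point
    as root and the other [n - 1] points on a circle, reduces
    [k * #|A| + k * #|B| <= k * 'C(n, k)] to arcs of length [q]: if some arc is in
    the second family, the two families have at most [2 * q] arcs together, hence
    at most [q] in the second, so that the sum weighted by 1 and [k] is at most
    [2 * q + q * q <= n - 1], which is where [n >= k ^ 2] enters. *)

Set Implicit Arguments.
Unset Strict Implicit.
Unset Printing Implicit Defensive.

Import Order.TTheory GRing.Theory Num.Theory.

(** * Counting arcs of length [q] on a circle *)

Lemma sum_nat_periodic (f : nat -> nat) (m i0 : nat) :
  (forall i, f (i + m) = f i) ->
  \sum_(0 <= i < m) f (i + i0) = \sum_(0 <= i < m) f i.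
Proof.
move=> fP; elim: i0 => [|i0 IH]; first by apply: eq_bigr => i _; rewrite addn0.
rewrite -IH; case: m fP {IH} => [|m] fP; first by rewrite !big_geq.
rewrite big_nat_recr // big_nat_recl //= addnC add0n; congr (_ + _).
  by rewrite -(fP i0); congr f; lia.
by apply: eq_bigr => i _; congr f; lia.
Qed.

(** Here [a i] and [b i] record whether the arc of length [q] starting at [i] lies in the first or
    the second family, and [d] runs over the offsets giving disjoint arcs. Once some [b i] holds,
    the sums [x] of [b] and [y] of [a] satisfy [x <= y] and [x + y <= 2 * q], so [y + q.+1 * x = (x
    + y) + q * x <= q * q.+2]. *)
Lemma cyclic_arcs_bound (m q : nat) (a b : nat -> bool) :
  0 < q -> q * q.+2 <= m ->
  (forall i, a (i + m) = a i) -> (forall i, b (i + m) = b i) ->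
  (forall i, b i -> a i) ->
  (forall i d, q <= d <= m - q -> b i -> ~~ a (i + d)) ->
  \sum_(0 <= i < m) a i + q.+1 * \sum_(0 <= i < m) b i <= m.
Proof.
move=> q0 qm aP bP ba ab.
have [/hasP[i0 _ bi0]|/hasPn nb] := boolP (has b (iota 0 m)); last first.
  have -> : \sum_(0 <= i < m) b i = 0.
    rewrite big_nat big1 // => i im.
    by have /negPf -> : ~~ b i by apply: nb; rewrite mem_iota.
  rewrite muln0 addn0 -[leqRHS]subn0 -[leqRHS]muln1 -sum_nat_const_nat.
  by apply: leq_sum => i _; case: (a i).
rewrite -(sum_nat_periodic i0 (f := a)) => [|i]; last by rewrite aP.
rewrite -(sum_nat_periodic i0 (f := b)) => [|i]; last by rewrite bP.
pose f i := a (i + i0) + b (i + i0).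
have q3 : q * 3 <= m by apply: leq_trans qm; rewrite leq_mul2l !ltnS q0 orbT.
have pair_le i d : q <= d <= m - q -> f i + f (i + d) <= 2.
  move=> dP; rewrite /f.
  have h1 : b (i + i0) -> ~~ a (i + d + i0).
    by move=> h; rewrite addnAC; apply: ab.
  have h2 : b (i + d + i0) -> ~~ a (i + i0).
    (* Disjointness is symmetric on the circle: the arc at [i] is reached from the one at [i + d] by
       going on for [m - d] steps. *)
    move=> h; rewrite -aP; have -> : i + i0 + m = i + d + i0 + (m - d) by lia.
    by apply: ab h; lia.
  move: h1 h2 (ba (i + i0)) (ba (i + d + i0)).
  by do 4!case: (_ (_ + i0)) => //=; lia.
(* Pair the arc at [i] with the disjoint arc at [i + m - q]. *)
have f2q : \sum_(0 <= i < m) f i <= q * 2.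
  rewrite (@big_cat_nat _ _ _ q) //=; last by lia.
  rewrite (@big_cat_nat _ _ _ (m - q).+1 q) //=; [|lia|lia].
  (* These arcs are disjoint from the arc at [i0], which is in the second family. *)
  have -> : \sum_(q <= i < (m - q).+1) f i = 0.
    rewrite big_nat big1 // => i iP.
    have na : ~~ a (i + i0) by rewrite addnC; apply: ab => //; lia.
    by rewrite /f (negPf na) (negPf (contraNN (ba _) na)).
  case: q q0 {ab qm} q3 pair_le => // q _ q3 pair_le.
  rewrite add0n big_nat_recl // -[(m - _).+1]add0n big_addn -addnA.
  have -> : m - (m - q.+1).+1 = q by lia.
  (* The first block has one arc more than the last: the arc at [i0] stays unpaired and contributes
     at most 2. *)
  rewrite -big_split /= mulSn leq_add //.
    by rewrite /f; case: (a _); case: (b _).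
  rewrite -[q in leqRHS]subn0 -sum_nat_const_nat; apply: leq_sum => i _.
  have -> : i + (m - q.+1).+1 = i.+1 + (m - q.+1) by lia.
  by apply: pair_le; lia.
move: f2q; rewrite /f big_split /=.
have : \sum_(0 <= i < m) b (i + i0) <= \sum_(0 <= i < m) a (i + i0).
  by apply: leq_sum => i _; move: (ba (i + i0)); case: (b _) => // ->.
by move: (\sum_(_ <= _ < _) _) (\sum_(_ <= _ < _) _) => x y; nia.
Qed.

Definition arc (m q i : nat) : {set 'I_m.+1} := [set inZp (i + t) | t : 'I_q].

Lemma arc_addm m q i : arc m q (i + m.+1) = arc m q i.
Proof.
by apply: eq_imset => t; apply: val_inj; rewrite /= addnAC modnDr.
Qed.

Lemma card_arc m q i : q <= m.+1 -> #|arc m q i| = q.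
Proof.
move=> qm; rewrite card_imset ?card_ord // => s t /(congr1 val) /= /eqP.
rewrite eqn_modDl !modn_small ?(leq_trans (ltn_ord _) qm) // => /eqP.
exact: val_inj.
Qed.

Lemma arc_disjoint m q i d :
  q <= d <= m.+1 - q -> q <= m.+1 -> [disjoint arc m q i & arc m q (i + d)].
Proof.
move=> dP qm; apply/pred0P => x /=; apply/negP => /andP[].
case/imsetP=> s _ -> /imsetP[t _ /(congr1 val) /= /eqP].
case/andP: dP (ltn_ord s) (ltn_ord t) => qd dm sq tq.
by rewrite -addnA eqn_modDl !modn_small => [/eqP||]; lia.
Qed.

(** * Rooted sets and the action of permutations on them *)

(* [k]-sets [S] of [A] with a marked element [b], encoded as [(S :\ b, b)]. *)
Definition rooted (T : finType) (A : {set {set T}}) : {set {set T} * T} :=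
  [set p : {set T} * T | (p.2 \notin p.1) && (p.2 |: p.1 \in A)].

Lemma card_rooted (T : finType) (A : {set {set T}}) :
  #|rooted A| = \sum_(S in A) #|S|.
Proof.
rewrite -sum1_card (partition_big (fun p => p.2 |: p.1) (mem A)); last first.
  by move=> p; rewrite inE => /andP[].
apply: eq_bigr => S SA.
have inj : injective (fun b => (S :\ b, b)) by move=> b c [].
rewrite -(card_imset _ inj) -sum1_card; apply: eq_bigl => -[X b].
rewrite !inE /=; apply/andP/imsetP => [[/andP[bX _] /eqP <-]|[c cS [-> ->]]].
  by exists b; rewrite ?setU11 // setU1K.
by rewrite setD11 setD1K ?SA.
Qed.

Definition rooted_uniform (T : finType) k : {set {set T} * T} :=
  rooted [set S : {set T} | #|S| == k].

Lemma rooted_uniformP (T : finType) q X (b : T) :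
  ((X, b) \in rooted_uniform T q.+1) = (b \notin X) && (#|X| == q).
Proof. by rewrite !inE /= cardsU1; case: (b \notin X) => //=; rewrite ?add1n. Qed.

Definition perm_rooted (T : finType) (s : {perm T}) (p : {set T} * T) :=
  (s @: p.1, s p.2).

Lemma perm_rootedM (T : finType) (s t : {perm T}) p :
  perm_rooted (s * t)%g p = perm_rooted t (perm_rooted s p).
Proof.
rewrite /perm_rooted permM -imset_comp; congr (_, _).
by apply: eq_imset => x; rewrite /= permM.
Qed.

Lemma perm_rooted_uniform (T : finType) q (s : {perm T}) p :
  p \in rooted_uniform T q.+1 -> perm_rooted s p \in rooted_uniform T q.+1.
Proof.
case: p => X b; rewrite !rooted_uniformP mem_imset ?card_imset //;
  exact: perm_inj.
Qed.

(** For each pair, list the root, then the set, then the remaining points; matching the two lists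
    position by position gives the permutation. *)
Lemma perm_rooted_trans (T : finType) q p p' :
  p \in rooted_uniform T q.+1 -> p' \in rooted_uniform T q.+1 ->
  exists s : {perm T}, perm_rooted s p = p'.
Proof.
case: p p' => [X b] [Y c]; rewrite !rooted_uniformP => /andP[bX /eqP cX].
case/andP=> cY /eqP cardY.
pose en (Z : {set T}) (d : T) := d :: enum Z ++ enum (~: (d |: Z)).
have en_uniq (Z : {set T}) (d : T) : d \notin Z -> uniq (en Z d).
  move=> dZ; rewrite /= mem_cat !mem_enum !inE eqxx orbF dZ cat_uniq !enum_uniq.
  rewrite andbT /=; apply/hasPn => x; rewrite !mem_enum !inE negb_or.
  by case/andP.
have en_all (Z : {set T}) (d x : T) : x \in en Z d.
  rewrite inE mem_cat !mem_enum !inE.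
  by case: (x == d) => //=; case: (x \in Z).
pose f x := nth b (en Y c) (index x (en X b)).
have size_en (Z : {set T}) (d : T) : d \notin Z -> size (en Z d) = #|T|.
  move=> dZ; rewrite -(card_uniqP (en_uniq _ _ dZ)); apply: eq_card => x.
  by rewrite en_all.
have f_inj : injective f.
  move=> x y /eqP; rewrite nth_uniq ?en_uniq ?(size_en Y) // -?(size_en X b) //.
  - by move=> /eqP; apply: (index_inj b); apply: en_all.
  - by rewrite index_mem en_all.
  - by rewrite index_mem en_all.
exists (perm f_inj); rewrite /perm_rooted /=; congr (_, _); last first.
  by rewrite permE /f /= eqxx.
apply/eqP; rewrite eqEcard card_imset; last exact: perm_inj.
rewrite cX cardY leqnn andbT; apply/subsetP => _ /imsetP[x xX ->].
have ix : index x (enum X) < size (enum X) by rewrite index_mem mem_enum.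
rewrite permE /f /= ifN; last by apply: contraNneq bX => ->.
rewrite index_cat mem_enum xX /= nth_cat -cardE cardY -cX cardE ix.
by rewrite -mem_enum mem_nth // -cardE cardY -cX cardE.
Qed.

(** By transitivity [N p] is the same for every rooted set [p]. Counting the preimages of [C] and of
    all rooted sets, then eliminating [N p0], gives the proportion without division. *)
Lemma card_perm_rooted (T : finType) q p0 (C : {set {set T} * T}) :
  p0 \in rooted_uniform T q.+1 -> C \subset rooted_uniform T q.+1 ->
  #|[set s : {perm T} | perm_rooted s p0 \in C]| * #|rooted_uniform T q.+1| =
  #|C| * #|{perm T}|.
Proof.
move=> p0P.
pose N p := #|[set s : {perm T} | perm_rooted s p0 == p]|.
have N_le p p' : p \in rooted_uniform T q.+1 -> p' \in rooted_uniform T q.+1 ->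
    N p <= N p'.
  move=> pP p'P; have [t tp] := perm_rooted_trans pP p'P.
  rewrite /N -(card_imset _ (mulIg t)); apply: subset_leq_card.
  apply/subsetP => _ /imsetP[s + ->]; rewrite !inE perm_rootedM => /eqP ->.
  exact/eqP.
have N_const p : p \in rooted_uniform T q.+1 -> N p = N p0.
  by move=> pP; apply/eqP; rewrite eqn_leq !N_le.
have cnt (D : {set {set T} * T}) : D \subset rooted_uniform T q.+1 ->
    #|[set s : {perm T} | perm_rooted s p0 \in D]| = #|D| * N p0.
  move=> /subsetP DP; rewrite -sum1_card.
  rewrite (partition_big (fun s => perm_rooted s p0) (mem D)) /=; last first.
    by move=> s; rewrite inE.
  rewrite -sum_nat_const; apply: eq_bigr => p pD.
  rewrite -(N_const p) ?DP // /N -sum1_card; apply: eq_bigl => s.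
  by rewrite !inE; case: eqP => [->|]; rewrite ?pD ?andbF.
move=> CP; rewrite cnt // -mulnA [N p0 * _]mulnC -cnt //; congr (_ * _).
by apply: eq_card => s; rewrite inE perm_rooted_uniform.
Qed.

(** * Averaging the arc bound over all circles *)

Lemma cross_intersecting_rooted (n q : nat) (A B : {set {set 'I_n} * 'I_n}) :
  0 < q -> q.+1 ^ 2 <= n ->
  A \subset rooted_uniform _ q.+1 -> B \subset A ->
  (forall X Y b, (X, b) \in B -> (Y, b) \in A -> ~~ [disjoint X & Y]) ->
  #|A| + q.+1 * #|B| <= #|rooted_uniform 'I_n q.+1|.
Proof.
case: n A B => [|[|m]] A B q0 qn AU BA AB; [nia|nia|].
(* The root is [ord_max], and [lift ord_max] places the circle of [m.+1] points on all the
   others. *)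
pose p0 i : {set 'I_m.+2} * 'I_m.+2 := (lift ord_max @: arc m q i, ord_max).
(* This is [q.+1 ^ 2 <= m.+2] with 1 removed from both sides, the removed point being the root. *)
have qm : q * q.+2 <= m.+1 by nia.
have qm1 : q <= m.+1 by nia.
have p0U i : p0 i \in rooted_uniform _ q.+1.
  rewrite rooted_uniformP card_imset ?card_arc ?eqxx ?andbT //; last first.
    exact: lift_inj.
  by apply/imsetP => -[x _] /eqP; rewrite (negPf (neq_lift _ _)).
have p0m i : p0 (i + m.+1) = p0 i by rewrite /p0 arc_addm.
have sum_le (s : {perm 'I_m.+2}) :
    \sum_(0 <= i < m.+1) (perm_rooted s (p0 i) \in A)
    + q.+1 * \sum_(0 <= i < m.+1) (perm_rooted s (p0 i) \in B) <= m.+1.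
  apply: cyclic_arcs_bound => // [i|i|i|i d dP iB]; rewrite ?p0m //.
    exact: (subsetP BA).
  apply/negP => iA; have /negP[] := AB _ _ _ iB iA.
  rewrite (imset_disjoint (@perm_inj _ s)) (imset_disjoint (@lift_inj _ _)).
  exact: arc_disjoint.
pose NC (C : {set {set 'I_m.+2} * 'I_m.+2}) i :=
  #|[set s : {perm 'I_m.+2} | perm_rooted s (p0 i) \in C]|.
have NCE (C : {set {set 'I_m.+2} * 'I_m.+2}) : \sum_s \sum_(0 <= i < m.+1) (perm_rooted s (p0 i) \in C) =
    \sum_(0 <= i < m.+1) NC C i.
  rewrite exchange_big /=; apply: eq_bigr => i _; rewrite /NC -sum1_card.
  by rewrite [RHS]big_mkcond /=; apply: eq_bigr => s _; rewrite inE; case: ifP.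
have NCU (C : {set {set 'I_m.+2} * 'I_m.+2}) : C \subset rooted_uniform _ q.+1 ->
    (\sum_(0 <= i < m.+1) NC C i) * #|rooted_uniform 'I_m.+2 q.+1| =
    m.+1 * (#|C| * #|{perm 'I_m.+2}|).
  move=> CU; rewrite big_distrl /=.
  under eq_bigr do rewrite card_perm_rooted //.
  by rewrite sum_nat_const_nat subn0.
have : \sum_(s : {perm 'I_m.+2}) (\sum_(0 <= i < m.+1) (perm_rooted s (p0 i) \in A)
    + q.+1 * \sum_(0 <= i < m.+1) (perm_rooted s (p0 i) \in B)) <=
   \sum_(s : {perm 'I_m.+2}) m.+1 by apply: leq_sum => s _.
rewrite big_split /= -big_distrr /= !NCE sum_nat_const.
have -> : #|[pred _ : {perm 'I_m.+2} | true]| = #|{perm 'I_m.+2}| by [].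
have P0 : 0 < #|{perm 'I_m.+2}| by apply/card_gt0P; exists 1%g.
have := NCU _ AU; have := NCU _ (subset_trans BA AU).
move: (\sum_(_ <= _ < _) _) (\sum_(_ <= _ < _) _) => x y hB hA h.
have : (x + q.+1 * y) * #|rooted_uniform 'I_m.+2 q.+1| <=
  #|{perm 'I_m.+2}| * m.+1 * #|rooted_uniform 'I_m.+2 q.+1|.
  by rewrite leq_mul2r h orbT.
rewrite mulnDl -mulnA hA hB [_ * m.+1]mulnC => le_mP.
(* The number of pairs of an arc and a permutation is a common factor, which cancels. *)
rewrite -(@leq_pmul2l (m.+1 * #|{perm 'I_m.+2}|)) ?muln_gt0 ?P0 //.
apply: leq_trans le_mP; move: #|A| #|B| #|{perm _}| => u v w; lia.
Qed.

(** Each [k]-set has [k] choices of root, so the claim multiplied by [k] is the weighted bound for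
    [rooted A] and [B]. *)
Lemma card_cross_intersecting (n k : nat) (A : {set {set 'I_n}})
    (B : {set {set 'I_n} * 'I_n}) :
  2 <= k -> k ^ 2 <= n ->
  (forall S, S \in A -> #|S| = k) -> B \subset rooted A ->
  (forall X S b, (X, b) \in B -> S \in A -> b \in S -> ~~ [disjoint X & S]) ->
  #|A| + #|B| <= 'C(n, k).
Proof.
case: k => // q q0 qn Ak BA AB.
have AU : rooted A \subset rooted_uniform _ q.+1.
  apply/subsetP => p; rewrite !inE => /andP[-> /Ak ->] /=; exact: eqxx.
have card_uniform (C : {set {set 'I_n}}) :
    (forall S, S \in C -> #|S| = q.+1) -> #|rooted C| = #|C| * q.+1.
  by move=> Ck; rewrite card_rooted -sum_nat_const; apply: eq_bigr => S /Ck.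
have -> : 'C(n, q.+1) = #|[set S : {set 'I_n} | #|S| == q.+1]|.
  by rewrite card_draws card_ord.
rewrite -(@leq_pmul2r q.+1) // -[leqRHS]card_uniform.
  rewrite mulnDl -card_uniform // [#|B| * _]mulnC.
  apply: cross_intersecting_rooted => // X Y b XB; rewrite inE /= => /andP[bY YA].
  (* Adding the root [b] to [Y] creates no common point with [X], because [b] is outside [X]. *)
  have := AB _ _ _ XB YA (setU11 _ _); apply: contraNN.
  have /(subsetP BA) := XB; rewrite inE /= => /andP[bX _] dXY.
  apply/pred0P => x /=; rewrite !inE; apply/negP => /andP[xX /orP[/eqP xb|xY]].
    by rewrite -xb xX in bX.
  by have /pred0P/(_ x) := dXY; rewrite /= xX xY.
by move=> S; rewrite inE => /eqP.
Qed.

(** * Shifting intersecting families *)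

Local Open Scope fset_scope.
Local Open Scope ring_scope.

Lemma intersectingP (R : realFieldType) n (F : {fset 'rV[R]_n}) :
  reflect (forall v w, v \in F -> w \in F -> -2 < scalar_prod v w)
          (intersecting F).
Proof.
apply: (iffP forallP) => [h v w vF wF | h v].
  by have /forallP/(_ [` wF]) := h [` vF].
by apply/forallP => w; apply: h; apply: valP.
Qed.

Lemma scalar_prodC (R : realFieldType) n (v w : 'rV[R]_n) :
  scalar_prod v w = scalar_prod w v.
Proof. by apply: eq_bigr => i _; rewrite mulrC. Qed.

Lemma scalar_prod_xcol (R : realFieldType) n (i j : 'I_n) (v w : 'rV[R]_n) :
  scalar_prod (xcol i j v) (xcol i j w) = scalar_prod v w.
Proof.
rewrite /scalar_prod [RHS](reindex_inj (@perm_inj _ (tperm i j))).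
by apply: eq_bigr => l _; rewrite !mxE.
Qed.

Lemma xcolK (R : realFieldType) n (i j : 'I_n) :
  involutive (@xcol R 1 n i j).
Proof. by move=> v; apply/rowP => l; rewrite !mxE tpermK. Qed.

(** Only the terms at [i] and [j] change. The factored form shows that the product cannot drop when
    [v 0 i < v 0 j] and [w 0 j <= w 0 i]. *)
Lemma scalar_prod_xcoll (R : realFieldType) n (i j : 'I_n) (v w : 'rV[R]_n) :
  scalar_prod (xcol i j v) w =
  scalar_prod v w + (v 0 j - v 0 i) * (w 0 i - w 0 j).
Proof.
have [->|ij] := eqVneq i j.
  rewrite subrr mul0r addr0; congr scalar_prod.
  by apply/rowP => l; rewrite mxE tperm1 perm1.
have split2 u : scalar_prod u w = u 0 i * w 0 i + (u 0 j * w 0 j +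
    \sum_(l < n | (l != i) && (l != j)) u 0 l * w 0 l).
  by rewrite /scalar_prod (bigD1 i) //= (bigD1 j) 1?eq_sym.
rewrite !split2 (eq_bigr (fun l => v 0 l * w 0 l)) => [|l /andP[li lj]].
  by rewrite !mxE tpermL tpermR; ring.
by rewrite mxE tpermD // eq_sym.
Qed.

Lemma xcol_Vnk1 (R : realFieldType) n k (i j : 'I_n) (v : 'rV[R]_n) :
  v \in Vnk1 R n k -> xcol i j v \in Vnk1 R n k.
Proof.
have cardE x : #|[set l | xcol i j v 0 l == x]| = #|[set l | v 0 l == x]|.
  rewrite -!sum1dep_card [RHS](reindex_inj (@perm_inj _ (tperm i j))).
  by apply: eq_bigl => l; rewrite mxE.
move=> /in_Vnk1[vE v1 vN1]; apply/in_Vnk1; rewrite !cardE; split=> // l.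
by rewrite mxE.
Qed.

(** A compression that moves the smaller entry to [j]; a vector whose swap is already in [F] stays
    put, which makes the map injective on [F]. *)
Definition shift_vec (R : realFieldType) n (i j : 'I_n) (F : {fset 'rV[R]_n})
    (v : 'rV[R]_n) : 'rV[R]_n :=
  if (v 0 i < v 0 j) && (xcol i j v \notin F) then xcol i j v else v.

Definition shift_fam (R : realFieldType) n (i j : 'I_n) (F : {fset 'rV[R]_n}) :=
  [fset shift_vec i j F v | v in F].

Lemma shift_vec_inj (R : realFieldType) n (i j : 'I_n) (F : {fset 'rV[R]_n}) :
  {in F &, injective (shift_vec i j F)}.
Proof.
move=> v w vF wF; rewrite /shift_vec.
case: ifP => [/andP[_ xv]|_]; case: ifP => [/andP[_ xw]|_] // e.
- exact: (inv_inj (@xcolK _ _ i j)).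
- by rewrite e wF in xv.
- by rewrite -e vF in xw.
Qed.

Lemma shift_vec_Vnk1 (R : realFieldType) n k (i j : 'I_n) (F : {fset 'rV[R]_n}) v :
  v \in Vnk1 R n k -> shift_vec i j F v \in Vnk1 R n k.
Proof. by rewrite /shift_vec; case: ifP => // _; apply: xcol_Vnk1. Qed.

Lemma shift_intersecting (R : realFieldType) n (i j : 'I_n)
    (F : {fset 'rV[R]_n}) :
  intersecting F -> intersecting (shift_fam i j F).
Proof.
move=> /intersectingP IF; apply/intersectingP => x y.
case/imfsetP=> v /= vF -> /imfsetP[w /= wF ->] {x y}.
(* Here [u] is swapped and [t] is kept. Either the swap of [t] lies in [F], and the swap can be
   carried over from [u] to [t], or [t] is ordered the other way, and swapping [u] does not lower
   the product. *)
have mixed u t : u \in F -> t \in F -> u 0 i < u 0 j ->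
    (t 0 i < t 0 j) && (xcol i j t \notin F) = false ->
    -2 < scalar_prod (xcol i j u) t.
  move=> uF tF uij; have [tij /negbFE xt|tij _] := ltP (t 0 i) (t 0 j).
    by rewrite -(scalar_prod_xcol i j) xcolK; apply: IF.
  rewrite scalar_prod_xcoll; apply: lt_le_trans (IF _ _ uF tF) _.
  by rewrite lerDl mulr_ge0 // subr_ge0 // ltW.
rewrite /shift_vec; case: ifP => [/andP[vij xv]|hv].
  case: ifP => [_|hw]; first by rewrite scalar_prod_xcol; apply: IF.
  exact: mixed.
case: ifP => [/andP[wij xw]|hw]; last exact: IF.
by rewrite scalar_prodC; apply: mixed.
Qed.

(** A family of least weight is closed under the swaps for all [i] at once; minimising replaces
    iterating shifts until they stabilise. *)
Lemma exists_shifted (R : realFieldType) n k (j : 'I_n) (F : {fset 'rV[R]_n}) :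
  F `<=` Vnk1 R n k -> intersecting F ->
  exists F' : {fset 'rV[R]_n},
    [/\ F' `<=` Vnk1 R n k, intersecting F', #|` F'| = #|` F| &
        forall i v, v \in F' -> v 0 i < v 0 j -> xcol i j v \in F'].
Proof.
move=> FV IF; have FP : F \in fpowerset (Vnk1 R n k) by rewrite fpowersetE.
pose good (G : fpowerset (Vnk1 R n k)) :=
  intersecting (val G) && (#|` val G| == #|` F|).
(* [wt] strictly decreases under any nontrivial shift. *)
pose wt (G : fpowerset (Vnk1 R n k)) : R := \sum_(v <- val G) v 0 j.
have good0 : good [` FP] by rewrite /good /= IF eqxx.
have [G /andP[IG /eqP cG] minG] := arg_minP wt good0.
have GV : val G `<=` Vnk1 R n k by rewrite -fpowersetE; apply: valP.
exists (val G); split=> // i v vG vij; apply: contraTT isT => xv.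
have SV : shift_fam i j (val G) \in fpowerset (Vnk1 R n k).
  rewrite fpowersetE; apply/fsubsetP => _ /imfsetP[w /= wG ->].
  by apply: shift_vec_Vnk1; apply: (fsubsetP GV).
have := minG [` SV]; rewrite /good /= shift_intersecting //=.
rewrite card_in_imfset; last exact: shift_vec_inj.
rewrite cG eqxx => /(_ isT); rewrite /wt /= big_imfset /=; last first.
  exact: shift_vec_inj.
(* The term of [v] drops from [v 0 j] to [v 0 i] and no other term grows, against minimality. *)
rewrite [leLHS](big_fsetD1 v) //= [leRHS](big_fsetD1 v) //= leNgt => /negP[].
apply: ltr_leD; first by rewrite /shift_vec vij xv /= mxE tpermR.
apply: ler_sum => w _; rewrite /shift_vec; case: ifP => // /andP[/ltW wij _].
by rewrite mxE tpermR.
Qed.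

(** * Splitting off the last coordinate *)

Lemma row_mx_last (R : realFieldType) n (v : 'rV[R]_(n + 1)) :
  v = row_mx (lsubmx v) (const_mx (v 0 (rshift n ord0))).
Proof.
rewrite -[LHS]hsubmxK; congr row_mx.
by apply/rowP => i; rewrite !mxE (ord1 i).
Qed.

Lemma row_mx_const_last (R : realFieldType) n (u : 'rV[R]_n) (c : R) :
  row_mx u (const_mx c) 0 (rshift n (ord0 : 'I_1)) = c.
Proof. by rewrite row_mxEr mxE. Qed.

Lemma scalar_prod_row_mx (R : realFieldType) n (u w : 'rV[R]_n) (a b : R) :
  scalar_prod (row_mx u (const_mx a : 'rV_1)) (row_mx w (const_mx b)) =
  scalar_prod u w + a * b.
Proof.
rewrite /scalar_prod big_split_ord /= big_ord1 !row_mxEr !mxE; congr (_ + _).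
by apply: eq_bigr => i _; rewrite !row_mxEl.
Qed.

Lemma row_mx_Vnk1 (R : realFieldType) n k (u : 'rV[R]_n) (c : R) :
  row_mx u (const_mx c) \in Vnk1 R (n + 1) k <->
  [/\ forall i, [\/ u 0 i = 0, u 0 i = 1 | u 0 i = -1],
      [\/ c = 0, c = 1 | c = -1],
      (#|[set i | u 0 i == 1]%R| + (c == 1)%R)%N = k &
      (#|[set i | u 0 i == -1]%R| + (c == -1)%R)%N = 1%N].
Proof.
have cardE x : #|[set i | row_mx u (const_mx c : 'rV_1) 0 i == x]| =
    (#|[set i | u 0 i == x]%R| + (c == x))%N.
  rewrite -!sum1dep_card big_mkcond [in RHS]big_mkcond big_split_ord /=.
  rewrite big_ord1 row_mxEr mxE; congr (_ + _)%N.
  by apply: eq_bigr => i _; rewrite row_mxEl.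
rewrite -!cardE; split=> [/in_Vnk1[h ? ?]|[h hc ? ?]].
  split=> // [i|]; first by have := h (lshift 1 i); rewrite row_mxEl.
  by have := h (rshift n ord0); rewrite row_mxEr mxE.
by apply/in_Vnk1; split=> // i; case: (split_ordP i) => l ->;
  rewrite ?row_mxEl // row_mxEr mxE.
Qed.

Definition neg_vec (R : realFieldType) n (S : {set 'I_n}) : 'rV[R]_(n + 1) :=
  row_mx (\row_i (i \in S)%:R) (const_mx (-1)).

(** The pair [(X, b)] is read as in [rooted]: swapping [b] with the last coordinate turns this
    vector into [neg_vec R (b |: X)]. *)
Definition pos_vec (R : realFieldType) n (p : {set 'I_n} * 'I_n) :
    'rV[R]_(n + 1) :=
  row_mx (\row_i (if i == p.2 then -1 else (i \in p.1)%:R)) (const_mx 1).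

Lemma neq_signs (R : realFieldType) :
  [/\ (1 == -1 :> R) = false, (-1 == 1 :> R) = false,
      (0 == -1 :> R) = false & (0 == 1 :> R) = false].
Proof. by split; apply/negbTE/negP => /eqP; lra. Qed.

Lemma neg_vec_Vnk1 (R : realFieldType) n (S : {set 'I_n}) :
  neg_vec R S \in Vnk1 R (n + 1) #|S|.
Proof.
have [e1 e2 e3 e4] := neq_signs R.
apply/row_mx_Vnk1; split.
- by move=> i; rewrite mxE; case: (i \in S); [constructor 2 | constructor 1].
- by constructor 3.
- rewrite e2 addn0; apply: eq_card => i; rewrite inE mxE.
  by case: (i \in S); rewrite ?eqxx ?e4.
- rewrite eqxx (_ : [set _ | _] = set0) ?cards0 //; apply/setP => i.
  by rewrite !inE mxE; case: (i \in S); rewrite ?e1 ?e3.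
Qed.

Lemma neg_vec_inj (R : realFieldType) n : injective (@neg_vec R n).
Proof.
move=> S S' /eq_row_mx[/rowP e _]; apply/setP => i; move: (e i); rewrite !mxE.
by case: (i \in S); case: (i \in S') => // /eqP; rewrite eqr_nat.
Qed.

(** * The recursion from [n] to [n + 1] *)

(** Two vectors ending in -1 gain 1 from the last coordinate and lose nothing elsewhere. Against a
    vector ending in 0, only the single -1 of the latter can contribute negatively, so the product
    is at least -1. *)
Lemma mnk1_succ_ge (R : realFieldType) n k :
  (mnk1 R n k + 'C(n, k) <= mnk1 R (n + 1) k)%N.
Proof.
pose N := [fset neg_vec R S | S in [set S : {set 'I_n} | #|S| == k]].
pose ext (u : 'rV[R]_n) : 'rV[R]_(n + 1) := row_mx u (const_mx 0).
have cN : #|` N| = 'C(n, k).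
  rewrite card_imfset /=; last exact: neg_vec_inj.
  by rewrite -cardE card_draws card_ord.
have [e1 e2 e3 e4] := neq_signs R.
have key (F : {fset 'rV[R]_n}) : F `<=` Vnk1 R n k -> intersecting F ->
    (#|` F| + 'C(n, k) <= mnk1 R (n + 1) k)%N.
  move=> /fsubsetP FV /intersectingP IF.
  pose E := [fset ext u | u in F].
  have cE : #|` E| = #|` F|.
    by rewrite card_imfset // => u w /eq_row_mx[].
  have dEN : E `&` N = fset0.
    apply/fsetP => v; rewrite !inE; apply/negP => /andP[/imfsetP[u _ ->]].
    case/imfsetP=> S _ /eq_row_mx[_ /rowP/(_ ord0)]; rewrite !mxE => /eqP.
    by rewrite e3.
  rewrite -cE -cN -cardfsUI dEN cardfs0 addn0.
  apply: leq_bigmax_seq.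
    rewrite fpowersetE; apply/fsubsetP => v.
    rewrite inE => /orP[/imfsetP[u /= uF ->]|/imfsetP[S /= + ->]].
      have /in_Vnk1[uE u1 uN1] := FV _ uF.
      apply/row_mx_Vnk1; rewrite e3 e4 !addn0; split=> //; by constructor 1.
    by rewrite inE => /eqP <-; apply: neg_vec_Vnk1.
  have mixed u S : u \in F -> -2 < scalar_prod (ext u) (neg_vec R S).
    move=> uF; have /in_Vnk1[uE _ uN1] := FV _ uF.
    rewrite scalar_prod_row_mx mul0r addr0.
    apply: (@lt_le_trans _ _ (-1)); first lra.
    (* Spreading -1 over the coordinates reduces the bound to a termwise comparison. *)
    have -> : -1 = \sum_(i < n) - (u 0 i == -1)%:R :> R.
      rewrite sumrN -natr_sum -big_mkcond sum1dep_card uN1 //.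
    apply: ler_sum => i _; rewrite mxE.
    by case: (uE i) => ->; rewrite ?e1 ?e3 ?eqxx; case: (i \in S) => /=; lra.
  apply/intersectingP => v w; rewrite !inE.
  move=> /orP[]/imfsetP[u /= uF ->] /orP[]/imfsetP[t /= tF ->].
  - by rewrite scalar_prod_row_mx mul0r addr0; apply: IF.
  - exact: mixed.
  - by rewrite scalar_prodC; apply: mixed.
  - rewrite scalar_prod_row_mx.
    have : 0 <= scalar_prod (\row_i (i \in u)%:R) (\row_i (i \in t)%:R) :> R.
      by apply: sumr_ge0 => i _; rewrite !mxE mulr_ge0 ?ler0n.
    lra.
(* The empty family gives this. It lets the binomial coefficient cross to the right as a truncated
   subtraction, leaving a bare maximum on the left. *)
have C_le : ('C(n, k) <= mnk1 R (n + 1) k)%N.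
  rewrite -[leqLHS]add0n -(cardfs0 'rV[R]_n); apply: key; first exact: fsub0set.
  by apply/intersectingP => v w; rewrite inE.
rewrite addnC -leq_subRL //; apply/bigmax_leqP_seq => F.
by rewrite fpowersetE leq_subRL // addnC; apply: key.
Qed.

Lemma mnk1_succ_le (R : realFieldType) n k : (2 <= k)%N -> (k ^ 2 <= n)%N ->
  (mnk1 R (n + 1) k <= mnk1 R n k + 'C(n, k))%N.
Proof.
move=> k2 kn; apply/bigmax_leqP_seq => F; rewrite fpowersetE => FV IF.
pose last : 'I_(n + 1) := rshift n (ord0 : 'I_1).
have {FV IF} [G [/fsubsetP GV /intersectingP IG <- shG]] :=
  exists_shifted last FV IF.
have [e1 e2 e3 e4] := neq_signs R.
pose ext (u : 'rV[R]_n) : 'rV[R]_(n + 1) := row_mx u (const_mx 0).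
pose G0 := [fset lsubmx v | v in [fset v in G | v 0 last == 0]].
have G0P u : u \in G0 -> ext u \in G.
  case/imfsetP=> v /=; rewrite !inE => /andP[vG /eqP v0] ->.
  by rewrite /ext -v0 -row_mx_last.
pose A := [set S : {set 'I_n} | (#|S| == k) && (neg_vec R S \in G)].
pose B := [set p : {set 'I_n} * 'I_n | (p.2 \notin p.1) && (pos_vec R p \in G)].
have G0_le : (#|` G0| <= mnk1 R n k)%N.
  apply: leq_bigmax_seq.
    rewrite fpowersetE; apply/fsubsetP => u /G0P/GV/row_mx_Vnk1.
    by rewrite e3 e4 !addn0 => -[uE _ u1 uN1]; apply/in_Vnk1.
  apply/intersectingP => u w /G0P uG /G0P wG; have := IG _ _ uG wG.
  by rewrite scalar_prod_row_mx mul0r addr0.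
have BA : B \subset rooted A.
  apply/subsetP => -[X b]; rewrite !inE /= => /andP[bX pG]; rewrite bX /=.
  have Xk : #|b |: X| = k.
    have /row_mx_Vnk1[_ _ <- _] := GV _ pG.
    rewrite eqxx addn1 cardsU1 bX add1n; congr _.+1; apply: eq_card => i.
    rewrite !inE mxE /=; have [->|_] := eqVneq i b; first by rewrite e2 (negPf bX).
    by case: (i \in X); rewrite ?eqxx ?e4.
  rewrite Xk eqxx /=.
  have -> : neg_vec R (b |: X) = xcol (lshift 1 b) last (pos_vec R (X, b)).
    apply/rowP => i; rewrite [RHS]mxE; case: (split_ordP i) => l ->.
      rewrite row_mxEl mxE !inE; case: tpermP => [/lshift_inj ->|/eqP|].
      - by rewrite row_mx_const_last eqxx.
      - by rewrite eq_lrshift.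
      - by move=> lb _; rewrite row_mxEl mxE; case: eqP lb => [->|].
    by rewrite (ord1 l) tpermR row_mxEl row_mx_const_last mxE /= eqxx.
  apply: shG => //; rewrite row_mx_const_last row_mxEl mxE /= eqxx; lra.
have AB_le : (#|A| + #|B| <= 'C(n, k))%N.
  apply: card_cross_intersecting => // [S|X S b].
    by rewrite inE => /andP[/eqP].
  rewrite !inE /= => /andP[bX pG] /andP[_ SG] bS; apply/negP => dXS.
  (* For disjoint [X] and [S], only [b] contributes among the first [n] coordinates, namely -1; the
     last coordinate gives another -1, for a total of the forbidden -2. *)
  have := IG _ _ pG SG; rewrite scalar_prod_row_mx.
  have -> : scalar_prod (\row_i (if i == b then -1 else (i \in X)%:R))
                        (\row_i (i \in S)%:R) = -1 :> R.
    rewrite /scalar_prod (bigD1 b) //= !mxE eqxx bS mulr1 big1 ?addr0 // => i ib.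
    rewrite !mxE (negPf ib); have /pred0P/(_ i) /= := dXS.
    by case: (i \in X); case: (i \in S); rewrite ?mulr0 ?mul0r.
  by lra.
have G_le : G `<=` [fset ext u | u in G0] `|`
    ([fset neg_vec R S | S in A] `|` [fset pos_vec R p | p in B]).
  apply/fsubsetP => v vG; have vE := row_mx_last v.
  have := vG; rewrite {1}vE => /GV/row_mx_Vnk1[uE cE u1 uN1].
  rewrite !inE; set u := lsubmx v in vE uE u1 uN1.
  (* The last entry and the counts [u1], [uN1] fix the shape of [v]: after a last entry 1 exactly
     one -1 remains, after -1 none does. *)
  case: cE => c; rewrite c ?eqxx ?e1 ?e2 ?e3 ?e4 in vE u1 uN1.
  - apply/or3P; constructor 1; rewrite {1}vE; apply: in_imfset => /=.
    by apply/imfsetP; exists v; rewrite // !inE vG c /=.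
  - apply/or3P; constructor 3; move/eqP: uN1; rewrite addn0 => /cards1P[b ub].
    have vp : v = pos_vec R ([set i | u 0 i == 1], b).
      rewrite vE; congr row_mx; apply/rowP => i; rewrite [RHS]mxE /=.
      have := congr1 (fun S : {set 'I_n} => i \in S) ub; rewrite !inE => <-.
      by case: (uE i) => ->; rewrite ?eqxx ?e1 ?e2 ?e3 ?e4.
    rewrite vp; apply: in_imfset; rewrite /= inE -vp vG andbT /= inE.
    have := congr1 (fun S : {set 'I_n} => b \in S) ub; rewrite !inE eqxx => /eqP ->.
    by rewrite e2.
  - apply/or3P; constructor 2; rewrite addn1 in uN1; case: uN1 => /cards0_eq u0.
    have vn : v = neg_vec R [set i | u 0 i == 1].
      rewrite vE; congr row_mx; apply/rowP => i; rewrite [RHS]mxE.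
      have := congr1 (fun S : {set 'I_n} => i \in S) u0; rewrite !inE.
      by case: (uE i) => ->; rewrite ?eqxx ?e4.
    by rewrite vn; apply: in_imfset; rewrite /= inE -vn vG andbT -u1 addn0.
apply: leq_trans (fsubset_leq_card G_le) _.
apply: leq_trans (leq_card_fsetU _ _).1 _; apply: leq_add.
  by apply: leq_trans G0_le; apply: leq_imfset_card.
apply: leq_trans (leq_card_fsetU _ _).1 _; apply: leq_trans AB_le.
by apply: leq_add; apply: leq_trans (leq_imfset_card _ _ _) _; rewrite /= -cardE.
Qed.

(** * Summing the recursion *)

Local Open Scope nat_scope.

Theorem corollary4 (R : realFieldType) (k n : nat)
    (hk : 2 <= k) (hn : k ^ 2 < n) :
  mnk1 R n k = mnk1 R (k ^ 2) k + \sum_(k ^ 2 <= j < n) 'C(j, k).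
Proof.
elim: n hn => // n IH; rewrite ltnS leq_eqVlt => /orP[/eqP <-|hn].
  (* Base case [n = k ^ 2] before the increment: the sum has a single term. *)
  rewrite big_nat1 -addn1; apply/eqP.
  by rewrite eqn_leq mnk1_succ_le // mnk1_succ_ge.
rewrite big_nat_recr ?(ltnW hn) //= addnA -IH // -addn1; apply/eqP.
by rewrite eqn_leq mnk1_succ_le ?(ltnW hn) // mnk1_succ_ge.
Qed.
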